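(* Schreier's space $S$ has the hereditary weak Dunford-Pettis property; that is, every closed subspace of $S$ has the weak Dunford-Pettis property.
   Context: A finite subset $A=\{n_1<\cdots<n_k\}$ of $\mathbb{N}=\{1,2,\dots\}$ is admissible if $k\le n_1$. Schreier's space $S$ is the completion of the space $c_{00}$ of finitely supported scalar sequences under the norm $\|x\|_S=\sup\{\sum_{j\in A}|x_j| : A\subset\mathbb{N}\text{ admissible}\}$, for $x=(x_j)$. A sequence $(x_n)$ in a Banach space $E$ is uniformly weakly convergent to $x\in E$ if for each $\epsilon>0$ there is $N(\epsilon)\in\mathbb{N}$ such that $\operatorname{card}\{n\in\mathbb{N}: |\phi(x_n-x)|\ge\epsilon\}\le N(\epsilon)$ for every $\phi\in E^*$ with $\|\phi\|\le1$; it is uniformly weakly null if it is uniformly weakly convergent to $0$. A Banach space $E$ has the weak Dunford-Pettis property if, whenever $(x_n)\subset E$ is uniformly weakly null and $(\phi_n)\subset E^*$ is weakly null, $\lim_n\phi_n(x_n)=0$. It has the hereditary weak Dunford-Pettis property if every closed subspace of $E$ has the weak Dunford-Pettis property. *)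

(* Defs.v *)
From HB Require Import structures.
From mathcomp Require Export all_boot all_order all_algebra finmap.
From mathcomp Require Export all_classical all_reals all_analysis.
From mathcomp Require Export complex.
Export Order.TTheory GRing.Theory Num.Theory.
Export numFieldNormedType.Exports.

Set Implicit Arguments.
Unset Strict Implicit.
Unset Printing Implicit Defensive.

Local Open Scope classical_set_scope.
Local Open Scope ring_scope.

(** The scalar field is an arbitrary [K : numFieldType] (instances of interest:
    [R] and [R[i]] for [R : realType]).  Norms are [K]-valued, and [0 <= x] in
    [R[i]] forces [x] to be real. *)

Section Dual.
Context {K : numFieldType} (E : normedModType K).

Definition is_dual : {pred (E -> K^o)} :=
  [pred f : E -> K^o | `[< linear f /\ continuous f >]].

Lemma is_dual_submod_closed : submod_closed is_dual.
Proof.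
split.
  apply/asboolP; split; last exact: cst_continuous.
  by move=> a u v; rewrite /= scaler0 addr0.
move=> a f g /asboolP[lf cf] /asboolP[lg cg]; apply/asboolP; split.
  move=> b u v.
  rewrite !fctE /= lf lg !scalerDr addrACA; congr (_ + _ + _).
  by rewrite !scalerA mulrC.
move=> x; apply: (@cvgD K K^o E (nbhs x) _ (a \*: f) g (a *: f x) (g x)).
  by apply: cvgZr; exact: cf.
exact: cg.
Qed.

HB.instance Definition _ :=
  GRing.isSubmodClosed.Build K (E -> K^o) is_dual is_dual_submod_closed.

Record dual : Type := Dual {
  dual_fun :> E -> K^o;
  dual_funP : dual_fun \in is_dual }.

HB.instance Definition _ := [isSub for dual_fun].
HB.instance Definition _ := [Choice of dual by <:].
HB.instance Definition _ := [SubChoice_isSubLmodule of dual by <:].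

Definition dual_unit_ball : set dual :=
  [set phi | forall x : E, `|phi x| <= `|x|].

Definition bounded_on_dual (F : dual -> K^o) : Prop :=
  [bounded F phi | phi in dual_unit_ball].

(** Weak convergence to 0 in the Banach space [E^*]: the test functionals are
    the elements of [E^**], not the evaluations at points of [E]. *)
Definition weakly_null_dual (phi : nat -> dual) : Prop :=
  forall F : {linear dual -> K^o},
    bounded_on_dual F -> F (phi n) @[n --> \oo] --> (0 : K^o).

Definition uniformly_weakly_cvg (x : nat -> E) (l : E) : Prop :=
  forall e : K, 0 < e -> exists N : nat, forall phi, dual_unit_ball phi ->
    ([set n | e <= `|phi (x n - l)|] #<= `I_N)%card.

Definition uniformly_weakly_null (x : nat -> E) : Prop :=
  uniformly_weakly_cvg x 0.

End Dual.

Section ClosedSubspace.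
Context {K : numFieldType}.

Record closed_subspace (E : normedModType K) := ClosedSubspace {
  subspace_carrier : set E;
  subspace_submod_closed : submod_closed [in subspace_carrier];
  subspace_closed : closed subspace_carrier }.

Arguments subspace_closed {E} Y : rename.

Section NormedModule.
Context {E : normedModType K} (Y : closed_subspace E).

Definition subspace_pred : {pred E} := [in subspace_carrier Y].

HB.instance Definition _ :=
  GRing.isSubmodClosed.Build K E subspace_pred (subspace_submod_closed Y).

(** [Y] as a Banach space of its own, with the norm of [E]. *)
Record subspace_type : Type := SubspaceElt {
  subspace_val : E;
  subspace_valP : subspace_val \in subspace_pred }.

HB.instance Definition _ := [isSub for subspace_val].
HB.instance Definition _ := [Choice of subspace_type by <:].
HB.instance Definition _ := [SubChoice_isSubLmodule of subspace_type by <:].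

Let norm (y : subspace_type) : K := `|\val y|.

Let norm_triangle x y : norm (x + y) <= norm x + norm y.
Proof. by rewrite /norm raddfD ler_normD. Qed.

Let normZ (a : K) x : norm (a *: x) = `|a| * norm x.
Proof. by rewrite /norm linearZ normrZ. Qed.

Let norm_eq0 x : norm x = 0 -> x = 0.
Proof.
by move=> /eqP; rewrite normr_eq0 => /eqP x0; apply: val_inj; rewrite x0 raddf0.
Qed.

HB.instance Definition _ :=
  @Lmodule_isNormed.Build K subspace_type norm norm_triangle normZ norm_eq0.

Lemma subspace_normE (y : subspace_type) : `|y| = `|\val y|.
Proof. by []. Qed.

End NormedModule.

Section Complete.
Context {E : completeNormedModType K} (Y : closed_subspace E).

Lemma subspace_complete (F : set_system (subspace_type Y)) :
  ProperFilter F -> cauchy F -> cvg F.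
Proof.
move=> FF cF.
have vE (a b : subspace_type Y) : `|\val a - \val b| = `|a - b|.
  by rewrite subspace_normE raddfB.
have cG : cauchy (\val @ F).
  apply/cauchyP => e e0; have /cauchyP /(_ e e0)[a Fa] := cF.
  exists (\val a); apply: (@filterS _ F _ (ball a e)) => [b|//].
  by rewrite /= -!ball_normE /ball_ /= -vE.
have /cvg_ex[l Gl] : cvg (\val @ F) by exact: cauchy_cvg.
have Yl : l \in subspace_pred Y.
  apply/mem_set; apply: (closed_cvg _ (subspace_closed Y) _ _ Gl).
  by apply: nearW => y; exact: set_mem (subspace_valP y).
apply/cvg_ex; exists (SubspaceElt Yl); apply/cvgrPdist_lt => e e0.
move/cvgrPdist_lt : Gl => /(_ e e0).
by apply: filterS => y; rewrite -vE.
Qed.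

HB.instance Definition _ :=
  Uniform_isComplete.Build (subspace_type Y) subspace_complete.

End Complete.
End ClosedSubspace.

Definition weak_Dunford_Pettis {K : numFieldType} (E : completeNormedModType K) :=
  forall (x : nat -> E) (phi : nat -> dual E),
    uniformly_weakly_null x -> weakly_null_dual phi ->
    phi n (x n) @[n --> \oo] --> (0 : K^o).

Definition hereditary_weak_Dunford_Pettis {K : numFieldType}
    (E : completeNormedModType K) :=
  forall Y : closed_subspace E, weak_Dunford_Pettis (subspace_type Y).

(** [i] exhibits the Banach space [E] as a completion of the normed space [X];
    this determines [E] up to a unique isometric isomorphism under [X]. *)
Definition is_completion {K : numFieldType} (X : normedModType K)
    (E : completeNormedModType K) (i : {linear X -> E}) : Prop :=
  (forall x, `|i x| = `|x|) /\ dense (range i).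

Section SchreierNorm.
Context (K : numFieldType).
Implicit Types (A B : {fset nat}).

(** Coordinates are numbered from 0: the index [j : nat] stands for the
    positive integer [j.+1], so that the condition [k <= n_1] reads
    [k <= j.+1] for the least, equivalently for every, [j \in A]. *)
Definition admissible A : Prop := forall j, j \in A -> (#|` A| <= j.+1)%N.

Definition is_c00 : {pred (nat -> K^o)} :=
  [pred x : nat -> K^o | `[< finite_set [set j | x j != 0] >]].

Lemma is_c00_submod_closed : submod_closed is_c00.
Proof.
split.
  apply/asboolP; rewrite (_ : [set _ | _] = set0)//.
  by apply/seteqP; split => // j /=; rewrite eqxx.
move=> a x y /asboolP fx /asboolP fy; apply/asboolP.
apply: (@sub_finite_set _ _ ([set j | x j != 0] `|` [set j | y j != 0])).
  move=> j /=; rewrite !fctE; have [->|] := eqVneq (x j) 0; last by left.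
  by rewrite scaler0 add0r; right.
by rewrite finite_setU.
Qed.

HB.instance Definition _ :=
  GRing.isSubmodClosed.Build K (nat -> K^o) is_c00 is_c00_submod_closed.

Record c00 : Type := C00 {
  c00_fun :> nat -> K^o;
  c00_funP : c00_fun \in is_c00 }.

HB.instance Definition _ := [isSub for c00_fun].
HB.instance Definition _ := [Choice of c00 by <:].
HB.instance Definition _ := [SubChoice_isSubLmodule of c00 by <:].

Definition admissible_sums (x : c00) : set K :=
  [set \sum_(j <- A) `|x j| | A in admissible].

(** [supremum 0 _] is the default value [0] on a set without least upper bound;
    [schreier_norm_supremum] shows that this case does not occur. *)
Definition schreier_norm (x : c00) : K := supremum 0 (admissible_sums x).

Lemma admissibleI A B : admissible A -> admissible (A `&` B)%fset.
Proof.
move=> aA j; rewrite in_fsetI => /andP[/aA + _]; apply: leq_trans.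
exact/fsubset_leq_card/fsubsetIl.
Qed.

Lemma admissible0 : admissible fset0.
Proof. by move=> j; rewrite in_fset0. Qed.

Lemma admissible1 j : admissible [fset j]%fset.
Proof. by move=> k _; rewrite cardfs1. Qed.

Let seq_max (T : eqType) (f : T -> K) (P : T -> Prop) (s : seq T) a :
  (forall t, 0 <= f t) -> P a ->
  exists2 b, P b & forall c, c \in a :: s -> P c -> f c <= f b.
Proof.
move=> f0 Pa; elim: s => [|t s [b Pb bmax]].
  by exists a => // c; rewrite inE => /eqP ->.
have [Pt|nPt] := pselect (P t); last first.
  exists b => // c; rewrite !inE => /or3P[ca|/eqP ->//|cs] Pc.
    by apply: bmax => //; rewrite inE ca.
  by apply: bmax => //; rewrite inE cs orbT.
have /orP[le_tb|le_bt] : (f t <= f b) || (f b <= f t).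
  exact: (real_leVge (ger0_real (f0 t)) (ger0_real (f0 b))).
  exists b => // c; rewrite !inE => /or3P[ca|/eqP ->//|cs] Pc.
    by apply: bmax => //; rewrite inE ca.
  by apply: bmax => //; rewrite inE cs orbT.
exists t => // c; rewrite !inE => /or3P[ca|/eqP ->//|cs] Pc;
  apply: le_trans le_bt; apply: bmax => //.
  by rewrite inE ca.
by rewrite inE cs orbT.
Qed.

Lemma schreier_norm_attained (x : c00) : exists2 A, admissible A &
  forall B, admissible B -> \sum_(j <- B) `|x j| <= \sum_(j <- A) `|x j|.
Proof.
have /asboolP/finite_fsetP[D xD] := c00_funP x.
have [A aA Amax] := @seq_max _ (fun A => \sum_(j <- A) `|x j|) admissible
  (enum_fset (fpowerset D)) fset0 (fun A => sumr_ge0 _ (fun j _ => normr_ge0 (x j)))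
  admissible0.
exists A => // B aB; apply: le_trans (Amax (B `&` D)%fset _ (admissibleI aB)).
  have -> : (B `&` D)%fset = [fset j in B | j \in D]%fset.
    by apply/fsetP => j; rewrite !inE.
  rewrite (big_fsetID _ [in D])/= gerDl big_seq big1// => j.
  rewrite !inE => /andP[_ jD]; apply/eqP; rewrite normr_eq0.
  apply: contraNT jD => xj0.
  by have : [set j | x j != 0] j by []; rewrite xD.
by rewrite inE; apply/orP; right; rewrite fpowersetE fsubsetIr.
Qed.

Lemma schreier_norm_supremum (x : c00) :
  supremums (admissible_sums x) (schreier_norm x).
Proof.
have [A aA Amax] := schreier_norm_attained x.
have sA : supremums (admissible_sums x) (\sum_(j <- A) `|x j|).
  split; first by move=> _ [B aB <-]; exact: Amax.
  by move=> u; apply; exists A.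
rewrite /schreier_norm /supremum ifF; first by case: xgetP => [y -> //|/(_ _ sA)].
by apply/negP => /eqP V0; have : set0 (\sum_(j <- A) `|x j|) by rewrite -V0; exists A.
Qed.

Lemma schreier_norm_ge (x : c00) A :
  admissible A -> \sum_(j <- A) `|x j| <= schreier_norm x.
Proof. by move=> aA; have [+ _] := schreier_norm_supremum x; apply; exists A. Qed.

Lemma schreier_norm_le (x : c00) M :
  (forall A, admissible A -> \sum_(j <- A) `|x j| <= M) -> schreier_norm x <= M.
Proof.
by move=> xM; have [_] := schreier_norm_supremum x; apply => _ [A aA <-]; exact: xM.
Qed.

Let schreier_norm_triangle x y :
  schreier_norm (x + y) <= schreier_norm x + schreier_norm y.
Proof.
apply: schreier_norm_le => A aA.
apply: (@le_trans _ _ (\sum_(j <- A) (`|x j| + `|y j|))).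
  by apply: ler_sum => j _; exact: ler_normD.
by rewrite big_split lerD// schreier_norm_ge.
Qed.

Let schreier_norm_scale_le (a : K) x :
  schreier_norm (a *: x) <= `|a| * schreier_norm x.
Proof.
apply: schreier_norm_le => A aA.
under eq_bigr do rewrite [c00_fun _ _]/(a * x _) normrM.
by rewrite -mulr_sumr ler_wpM2l// schreier_norm_ge.
Qed.

Let schreier_normZ (a : K) x : schreier_norm (a *: x) = `|a| * schreier_norm x.
Proof.
apply/eqP; rewrite eq_le schreier_norm_scale_le/=.
have [->|a0] := eqVneq a 0.
  rewrite normr0 mul0r.
  by have := schreier_norm_ge (0 *: x) admissible0; rewrite big_seq_fset0.
have := schreier_norm_scale_le a^-1 (a *: x).
by rewrite scalerA mulVf// scale1r normfV -ler_pdivrMl ?invr_gt0 ?normr_gt0// invrK.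
Qed.

Let schreier_norm_eq0 x : schreier_norm x = 0 -> x = 0.
Proof.
move=> x0; apply: val_inj; apply/funext => j.
have := schreier_norm_ge x (@admissible1 j).
by rewrite x0 big_seq_fset1 normr_le0 => /eqP.
Qed.

HB.instance Definition _ := @Lmodule_isNormed.Build K c00 schreier_norm
  schreier_norm_triangle schreier_normZ schreier_norm_eq0.

Lemma c00_normE (x : c00) : `|x| = schreier_norm x.
Proof. by []. Qed.

End SchreierNorm.

Definition is_schreier_space {K : numFieldType} (S : completeNormedModType K) :=
  exists i : {linear c00 K -> S}, is_completion i.

(* Main.v *)
(** Let [(x n)] be uniformly weakly null in a closed subspace of [S].  It is
    bounded and its coordinates tend to 0 uniformly, since otherwise a signed
    sum of coordinate functionals over an admissible set would be large at too
    many [x n].  A bounded sequence in [S] with uniformly small coordinates has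
    a subsequence [x (m i)] with a [c_0] upper estimate, so
    [F phi = \sum_i phi (x (m i))] is a bounded functional on the dual.  If
    [(phi n)] is weakly null and [phi n (x n)] does not tend to 0, then [m] can
    be chosen so that [phi (m i) (x (m i))] dominates [F (phi (m i))], which
    contradicts [F (phi n) --> 0].  The scalar field enters only through its
    completeness and the convergence of absolutely summable series. *)

From HB Require Import structures.
From mathcomp Require Import ring.
Require Import Defs.

Set Implicit Arguments.
Unset Strict Implicit.
Unset Printing Implicit Defensive.

Local Open Scope classical_set_scope.
Local Open Scope ring_scope.

(** * Functionals and uniformly weakly null sequences *)

Section DualTheory.
Context {K : numFieldType} {E : normedModType K}.
Implicit Types (phi psi : dual E) (x : nat -> E).

Lemma dual_linear phi : linear phi.
Proof. by have /asboolP[] := dual_funP phi. Qed.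

HB.instance Definition _ phi :=
  GRing.isLinear.Build K E K^o *:%R (dual_fun phi) (dual_linear phi).

Lemma dualDE phi psi y : (phi + psi) y = phi y + psi y.
Proof. by []. Qed.

Lemma dualZE a phi y : (a *: phi) y = a * phi y.
Proof. by []. Qed.

Lemma dualZ a phi y : phi (a *: y) = a * phi y.
Proof. exact: linearZ. Qed.

Lemma dual_sumE (I : Type) (s : seq I) (F : I -> dual E) y :
  (\sum_(i <- s) F i) y = \sum_(i <- s) F i y.
Proof. by elim/big_rec2: _ => // i a phi _ <-. Qed.

Lemma is_dual_bounded (f : E -> K^o) (M : K) : linear f ->
  (forall y, `|f y| <= M * `|y|) -> f \in @is_dual K E.
Proof.
move=> lf fM; apply/asboolP; split => //.
pose g : {linear E -> K^o} := HB.pack f (GRing.isLinear.Build _ _ _ _ f lf).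
apply: (@bounded_linear_continuous _ _ _ g); apply/linear_boundedP.
(* A bound valid at one nonzero vector forces [0 <= M], so [M] is real; on the zero space the bound
   0 serves. *)
have M0 (y : E) : y != 0 -> M \is Num.real.
  move=> y0; apply: (@ger0_real _ M).
  by rewrite -(@pmulr_lge0 _ `|y|) ?normr_gt0// (le_trans _ (fM y)).
have [[y y0]|all0] := pselect (exists y : E, y != 0).
  exists M; split; first exact: M0 y0.
  by move=> r /ltW Mr z; apply: le_trans (fM z) _; rewrite ler_wpM2r.
exists 0; split => // r _ z.
have [->|z0] := eqVneq z 0; last by case: all0; exists z.
by rewrite linear0 !normr0 mulr0.
Qed.

Lemma dual_bounded phi : exists2 M : K, 0 < M & forall y, `|phi y| <= M * `|y|.
Proof.
have /asboolP[_ cphi] := dual_funP phi.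
have /linear_boundedP[M [Mr bM]] :=
  @continuous_linear_bounded _ _ _ 0 (phi : {linear E -> K^o}) (cphi 0).
exists (`|M| + 1); first by rewrite ltr_wpDl.
apply: bM; rewrite ltr_pwDr//; exact: real_ler_norm.
Qed.

Lemma dual_unit_ball_scale phi : exists2 M : K, 0 < M & dual_unit_ball (M^-1 *: phi).
Proof.
have [M M0 bM] := dual_bounded phi; exists M => // y.
by rewrite dualZE normrM normfV (gtr0_norm M0) ler_pdivrMl.
Qed.

Lemma dual_unit_ball_comb a b phi psi : `|a| + `|b| <= 1 ->
  dual_unit_ball phi -> dual_unit_ball psi -> dual_unit_ball (a *: phi + b *: psi).
Proof.
move=> ab1 bphi bpsi y; rewrite dualDE !dualZE (le_trans (ler_normD _ _))//.
rewrite !normrM (@le_trans _ _ (`|a| * `|y| + `|b| * `|y|))//.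
  by apply: lerD; apply: ler_wpM2l.
by rewrite -mulrDl ler_piMl.
Qed.

Lemma seq_card_le (s : seq nat) (A : set nat) N :
  uniq s -> {in s, forall n, A n} -> (A #<= `I_N)%card -> (size s <= N)%N.
Proof.
move=> us sA AN.
have := card_le_trans (subset_card_le (_ : [set` [fset n in s]%fset] `<=` A)) AN.
have /card_eq_fsetP e : #|` [fset n in s]%fset| = size s by rewrite card_fseq undup_id.
rewrite (card_le_eql e) card_le_II; apply => n /=; rewrite !inE; exact: sA.
Qed.

Lemma uniformly_weakly_null_card x (e : K) : uniformly_weakly_null x -> 0 < e ->
  exists N, forall phi (s : seq nat), dual_unit_ball phi -> uniq s ->
    {in s, forall n, e <= `|phi (x n)|} -> (size s <= N)%N.
Proof.
move=> x0 e0; have [N xN] := x0 e e0; exists N => phi s bphi us sphi.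
apply: seq_card_le us _ (xN phi bphi) => n /sphi; rewrite /= subr0//.
Qed.

(** Once [phi] is scaled into the unit ball, only finitely many [n] can keep [|phi (x n)|] at or
    above a given threshold. *)
Lemma uniformly_weakly_null_cvg x phi : uniformly_weakly_null x ->
  phi (x n) @[n --> \oo] --> (0 : K^o).
Proof.
move=> x0; have [M M0 bM] := dual_unit_ball_scale phi.
apply/cvgr0Pnorm_lt => e e0.
have [N /(_ _ bM)/card_le_finite/(_ (finite_II _))] := x0 (e / M) (divr_gt0 e0 M0).
move=> /finite_seqP[s sE]; exists (\max_(i <- s) i).+1 => //= n /= sn.
rewrite real_ltNge ?ger0_real//; last exact: ltW.
apply/negP => en.
suff ns : n \in s.
  by have := @leq_bigmax_seq _ s xpredT id n ns isT; rewrite leqNgt sn.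
have : [set` s] n; last by [].
rewrite -sE; change (e / M <= `|(M^-1 *: phi) (x n - 0)|).
rewrite subr0 dualZE normrM normfV (gtr0_norm M0) mulrC ler_pM2l ?invr_gt0//.
Qed.

Lemma weakly_null_dual_eval (phi : nat -> dual E) y : weakly_null_dual phi ->
  phi n y @[n --> \oo] --> (0 : K^o).
Proof.
move=> phi0; pose ev (psi : dual E) : K^o := psi y.
have lev : linear ev by move=> a u v; rewrite /ev dualDE dualZE.
pose F : {linear dual E -> K^o} := HB.pack ev (GRing.isLinear.Build _ _ _ _ ev lev).
apply: (phi0 F); exists `|y|; split => // M yM psi bpsi.
exact: le_trans (bpsi y) (ltW yM).
Qed.

Lemma near_all (T : eqType) (s : seq T) (P : T -> nat -> Prop) :
  {in s, forall t, \forall n \near \oo, P t n} ->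
  \forall n \near \oo, {in s, forall t, P t n}.
Proof.
elim: s => [|t s IH] sP; first by apply: nearW.
have Pt : \forall n \near \oo, P t n by apply: sP; rewrite mem_head.
have Ps : \forall n \near \oo, {in s, forall t, P t n}.
  by apply: IH => u us; apply: sP; rewrite in_cons us orbT.
near=> n => u; rewrite in_cons => /orP[/eqP ->|us]; first by near: n.
by move: u us; near: n.
Unshelve. all: by end_near. Qed.

(** The norms of [a + b] and [a - b] add up to at least [2 |b|], so one of the signs [t = 1],
    [t = -1] prevents cancellation. *)
Lemma norm_pm (a b : K) : exists2 t : K, `|t| = 1 & `|b| <= `|a + t * b|.
Proof.
have [le_b|lt_b] := boolP (`|b| <= `|a + b|).
  by exists 1; rewrite ?normr1 ?mul1r.
exists (-1); first by rewrite normrN1.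
rewrite mulN1r; move: lt_b; rewrite -real_ltNge ?ger0_real// => lt_b.
have : `|b| + `|b| <= `|a + b| + `|a - b|.
  apply: le_trans (ler_normB (a + b) (a - b)).
  by rewrite opprB [a + b + _]addrC addrA subrK -mulr2n normrMn mulr2n.
by move=> /le_trans/(_ (lerD (ltW lt_b) (lexx _))); rewrite lerD2l.
Qed.
End DualTheory.

(** * Schreier coordinates *)

Section Phase.
Context {K : numFieldType}.
Implicit Type a : K.

(** Since [0^-1 = 0], [phase 0 = 0]. *)
Definition phase a : K := `|a| / a.

Lemma phaseM a : phase a * a = `|a|.
Proof.
by have [->|a0] := eqVneq a 0; rewrite ?mulr0 ?normr0// /phase divfK.
Qed.

Lemma norm_phase_le1 a : `|phase a| <= 1.
Proof.
have [->|a0] := eqVneq a 0; first by rewrite /phase invr0 mulr0 normr0 ler01.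
by rewrite /phase normrM normfV normr_id divff// normr_eq0.
Qed.

End Phase.

Section SchreierCoordinates.
Context {K : numFieldType} {E : normedModType K}.

(** These three properties are all that the argument uses of Schreier's space. Each concerns one
    vector at a time, so they pass to closed subspaces, which is where heredity comes from. *)
Record schreier_coordinates (c : nat -> dual E) : Prop := SchreierCoordinates {
  coord_sum_le : forall A y, admissible A -> \sum_(j <- A) `|c j y| <= `|y|;
  coord_norming : forall (y : E) (e : K), 0 < e ->
    exists2 A, admissible A & `|y| <= \sum_(j <- A) `|c j y| + e;
  coord_tail : forall (y : E) (e : K), 0 < e -> exists J, forall A, admissible A ->
    {in A, forall j, (J <= j)%N} -> \sum_(j <- A) `|c j y| <= e }.

Variable c : nat -> dual E.
Hypothesis cS : schreier_coordinates c.

Lemma coord_cvg0 y : c j y @[j --> \oo] --> (0 : K^o).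
Proof.
apply/cvgr0Pnorm_le => e e0; have [J cJ] := coord_tail cS y e0.
exists J => // j /= Jj; have := cJ _ (@admissible1 j).
by rewrite big_seq_fset1; apply => k; rewrite in_fset1 => /eqP ->.
Qed.

(** Phases align the coordinates over a nearly norming admissible set, so that the value at [y] is
    the whole sum of moduli; admissibility keeps the combination in the unit ball. *)
Lemma norming_functional y (e : K) : 0 < e ->
  exists2 psi : dual E, dual_unit_ball psi & `|y| <= `|psi y| + e.
Proof.
move=> e0; have [A aA yA] := coord_norming cS y e0.
exists (\sum_(j <- A) phase (c j y) *: c j ) => [z|].
  rewrite dual_sumE (le_trans _ (coord_sum_le cS z aA))//.
  apply: le_trans (ler_norm_sum _ _ _) _; apply: ler_sum => j _.
  by rewrite dualZE normrM ler_piMl// norm_phase_le1.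
rewrite dual_sumE; under eq_bigr do rewrite dualZE phaseM.
by rewrite ger0_norm// sumr_ge0.
Qed.

Section UniformlyWeaklyNull.
Variable x : nat -> E.
Hypothesis x0 : uniformly_weakly_null x.

(** If [(x n)] were unbounded, a finite gliding hump would give, for each [m],
    one functional of the unit ball of size at least 1 at [m] of the [x n]; at
    each stage the sign of the new summand is chosen by [norm_pm] so that it
    does not cancel what is already there. *)
Lemma uniformly_weakly_null_bounded :
  exists2 B : K, 0 <= B & forall n, `|x n| <= B.
Proof.
apply: contrapT => nB.
have big (C : K) : 0 <= C -> exists n, C < `|x n|.
  move=> C0; apply: contrapT => nC; apply: nB; exists C => // n.
  rewrite real_leNgt ?ger0_real//; apply/negP => Cn; apply: nC; by exists n.
have P m : forall C : K, 0 <= C -> exists (s : seq nat) (phi : dual E),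
    [/\ uniq s, size s = m, dual_unit_ball phi & {in s, forall n, C <= `|phi (x n)|}].
  elim: m => [|m IH] C C0.
    by exists [::], 0; split => // y; rewrite normr0.
  have C2 : 0 <= 2 * C + 1 by rewrite addr_ge0// mulr_ge0.
  (* The value [2 * C + 1] pays for a perturbation of at most 1 by the new functional and for the
     factor [2^-1] that keeps the combination in the unit ball. *)
  have [s [phi [us sm bphi sphi]]] := IH (2 * C + 1) C2.
  pose X := \sum_(l <- s) `|x l|; have X0 : 0 <= X by rewrite sumr_ge0.
  have X1 : 0 < 1 + X by rewrite ltr_wpDr.
  have xX l : l \in s -> `|x l| <= X.
    by move=> ls; rewrite /X (big_rem l)//= lerDl sumr_ge0.
  have C3 : 0 <= 1 + 2 * C * (1 + X) by rewrite addr_ge0// mulr_ge0 ?(ltW X1)// mulr_ge0.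
  (* The threshold exceeds [X], so [n] is new; and after losing the error 1 of [psi] and dividing by
     [1 + X], at least [2 * C] remains at [x n]. *)
  have [n nX] := big _ (addr_ge0 C3 X0).
  have ns : n \notin s.
    apply/negP => /xX/(lt_le_trans nX).
    by rewrite gtrDr => /(le_lt_trans C3); rewrite ltxx.
  have [psi bpsi npsi] := norming_functional (x n) (@ltr01 K).
  pose t := (1 + X)^-1; have t0 : 0 < t by rewrite invr_gt0.
  have t1 : t <= 1 by rewrite invf_le1// lerDl.
  have [z z1 zpsi] := norm_pm (phi (x n)) (t * psi (x n)).
  exists (n :: s), (2^-1 *: phi + (2^-1 * z * t) *: psi); split => //=.
  - by rewrite ns.
  - by rewrite sm.
  - apply: dual_unit_ball_comb => //.
    rewrite !normrM z1 mulr1 normfV normr_nat (gtr0_norm t0).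
    apply: (@le_trans _ _ (2^-1 + 2^-1)); first by rewrite lerD2l ler_piMr.
    by rewrite -[2^-1]mul1r -splitr.
  have half l : `|(2^-1 *: phi + (2^-1 * z * t) *: psi) (x l)| =
      2^-1 * `|phi (x l) + z * (t * psi (x l))|.
    by rewrite dualDE !dualZE -!mulrA -mulrDr normrM normfV normr_nat.
  move=> l; rewrite in_cons half => /orP[/eqP ->|ls].
    rewrite ler_pdivlMl// (le_trans _ zpsi)// normrM (gtr0_norm t0).
    rewrite ler_pdivlMl// -(lerD2r 1) (le_trans _ npsi)// (le_trans _ (ltW nX))//.
    by rewrite [(1 + X) * _]mulrC addrC lerDl.
  rewrite ler_pdivlMl// -(lerD2r 1) (le_trans (sphi _ ls))//.
  rewrite -[in leLHS](addrK (z * (t * psi (x l))) (phi (x l))).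
  apply: le_trans (ler_normB _ _) _; rewrite lerD2l normrM z1 mul1r normrM.
  rewrite (gtr0_norm t0) ler_pdivrMl// mulr1 (le_trans (bpsi _))//.
  by rewrite (le_trans (xX _ ls))// lerDr.
have [N xN] := uniformly_weakly_null_card x0 (@ltr01 K).
have [s [phi [us sN bphi sphi]]] := P N.+1 1 ler01.
by have := xN _ _ bphi us sphi; rewrite sN ltnn.
Qed.

(** Otherwise there are [N.+1] vectors [x n] with large coordinates at distinct
    places [j > N].  These places form an admissible set, so a suitable signed
    sum of the coordinate functionals lies in the unit ball. *)
Lemma uniformly_weakly_null_coord (e : K) : 0 < e ->
  \forall n \near \oo, forall j, `|c j (x n)| < e.
Proof.
move=> e0; apply: contrapT => nx.
have big M : exists n j, (M <= n)%N /\ e <= `|c j (x n)|.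
  apply: contrapT => nM; apply: nx; exists M => // n /= Mn j.
  rewrite (real_ltNge (normr_real _) (gtr0_real e0)); apply/negP => ej.
  by apply: nM; exists n, j.
have e20 : 0 < e / 2 by rewrite divr_gt0.
have e2e : e / 2 < e by rewrite ltr_pdivrMr// mulr_natr mulr2n ltrDl.
have [N xN] := uniformly_weakly_null_card x0 e20.
have P m : exists (s : seq nat) (psi : dual E) (A : {fset nat}), [/\ uniq s, size s = m,
    (#|` A| <= m)%N /\ {in A, forall j, (N < j)%N},
    forall y, `|psi y| <= \sum_(j <- A) `|c j y| &
    {in s, forall n, e / 2 < `|psi (x n)|}].
  elim: m => [|m [s [psi [A [us sm [Am NA] psiA spsi]]]]].
    exists [::], 0, fset0; split => // y; by rewrite big_seq_fset0 normr0.
  (* Beyond [J], a new coordinate perturbs [psi] at each earlier [x n] by less than its strict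
     surplus over [e / 2]. *)
  have [J _ sJ] : \forall j \near \oo, [/\ (N < j)%N, {in A, forall i, i < j}%N &
      {in s, forall n, `|c j (x n)| < `|psi (x n)| - e / 2}].
    have nA : \forall j \near \oo, {in enum_fset A, forall i, (i < j)%N}.
      by apply: near_all => i _; exact: nbhs_infty_gt.
    have ns : \forall j \near \oo,
        {in s, forall n, `|c j (x n)| < `|psi (x n)| - e / 2}.
      apply: near_all => l /spsi; rewrite -subr_gt0 => l0.
      by have /cvgr0Pnorm_lt := coord_cvg0 (x l); exact.
    near=> k; split; near: k => //; exact: nbhs_infty_gt.
  (* Far along the sequence the coordinates below [J] are under [e], so the large coordinate found
     next sits at a place [j' >= J]. *)
  have [M' _ MJ] : \forall n \near \oo, {in s, forall l, (l < n)%N} /\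
      {in iota 0 J, forall j, `|c j (x n)| < e}.
    have ns : \forall n \near \oo, {in s, forall l, (l < n)%N}.
      by apply: near_all => i _; exact: nbhs_infty_gt.
    have nJ : \forall n \near \oo, {in iota 0 J, forall j, `|c j (x n)| < e}.
      apply: near_all => i _.
      by have /cvgr0Pnorm_lt := uniformly_weakly_null_cvg (c i) x0; exact.
    by near=> l; split; near: l.
  have [n' [j' [Mn ej]]] := big M'; have [ns nJ] := MJ _ Mn.
  have Jj : (J <= j')%N.
    rewrite leqNgt; apply/negP => jJ.
    have := nJ j'; rewrite mem_iota jJ => /(_ isT).
    rewrite (real_ltNge (normr_real _) (gtr0_real e0)).
    by rewrite ej.
  have [Nj Aj sj] := sJ _ Jj.
  have jA : j' \notin A by apply/negP => /Aj; rewrite ltnn.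
  have [z z1 zc] := norm_pm (psi (x n')) (c j' (x n')).
  exists (n' :: s), (psi + z *: c j'), (j' |` A)%fset; split.
  - by rewrite /= us andbT; apply/negP => /ns; rewrite ltnn.
  - by rewrite /= sm.
  - split; first by rewrite cardfsU1 jA.
    by move=> i; rewrite in_fset1U => /orP[/eqP ->//|/NA].
  - move=> y; rewrite big_fsetU1// addrC dualDE dualZE.
    by rewrite (le_trans (ler_normD _ _))// normrM z1 mul1r lerD.
  move=> l; rewrite in_cons => /orP[/eqP ->|ls].
    by rewrite dualDE dualZE (lt_le_trans _ zc)// (lt_le_trans e2e).
  have := sj _ ls; rewrite ltrBrDl -ltrBrDr => /lt_le_trans; apply.
  rewrite dualDE dualZE lerBlDr.
  rewrite -[in leLHS](addrK (z * c j' (x l)) (psi (x l))).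
  by apply: le_trans (ler_normB _ _) _; rewrite lerD2l normrM z1 mul1r.
have [s [psi [A [us sN [AN NA] psiA spsi]]]] := P N.+1.
have aA : admissible A by move=> j /NA Nj; rewrite (leq_trans AN)// ltnW.
have bpsi : dual_unit_ball psi.
  by move=> y; exact: le_trans (psiA y) (coord_sum_le cS y aA).
by have := xN psi s bpsi us (fun n ns => ltW (spsi n ns)); rewrite sN ltnn.
Unshelve. all: by end_near. Qed.

(** An admissible set either lies in the tail where [u] is negligible, or it
    meets [0, J), has at most [J] elements, and the small coordinates of [x n]
    are negligible on it. *)
Lemma coord_sum_step (u : nat -> K) (B C e : K) :
  (forall e : K, 0 < e -> exists J, forall A, admissible A ->
    {in A, forall j, (J <= j)%N} -> \sum_(j <- A) u j <= e) ->
  (forall n, `|x n| <= B) -> B <= C ->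
  (forall A, admissible A -> \sum_(j <- A) u j <= C) -> 0 < e ->
  \forall n \near \oo, forall A, admissible A ->
    \sum_(j <- A) (u j + `|c j (x n)|) <= C + e.
Proof.
move=> tu xB BC uC e0; have [J uJ] := tu e e0.
have eJ : 0 < e / J.+1%:R by rewrite divr_gt0.
near=> n => A aA; rewrite big_split/=.
have nJ j : `|c j (x n)| < e / J.+1%:R.
  by move: j; near: n; exact: uniformly_weakly_null_coord.
have [[a aA' aJ]|AJ] := pselect (exists2 a, a \in A & (a < J)%N); last first.
  rewrite addrC lerD//.
    by rewrite (le_trans (coord_sum_le cS _ aA))// (le_trans (xB _)).
  by apply: uJ => // j jA; rewrite leqNgt; apply/negP => jJ; apply: AJ; exists j.
rewrite lerD ?uC//.
apply: (@le_trans _ _ (\sum_(j <- A) (e / J.+1%:R))).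
  by apply: ler_sum => j _; exact: ltW.
rewrite big_const_seq count_predT iter_addr_0 -[leLHS]mulr_natl mulrCA ler_piMr ?(ltW e0)//.
rewrite ler_pdivrMr// mul1r ler_nat (leq_trans (aA _ aA'))// ltnW//.
Unshelve. all: by end_near. Qed.

End UniformlyWeaklyNull.
End SchreierCoordinates.

(** * Selection of a subsequence with a c_0 upper estimate *)

Section Selection.
Context {K : numFieldType} {E : normedModType K}.
Variable c : nat -> dual E.
Hypothesis cS : schreier_coordinates c.
Variable x : nat -> E.
Hypothesis x0 : uniformly_weakly_null x.

Let u (s : seq nat) j := \sum_(l <- s) `|c j (x l)|.

Lemma coord_sum_tail s (e : K) : 0 < e -> exists J, forall A, admissible A ->
  {in A, forall j, (J <= j)%N} -> \sum_(j <- A) u s j <= e.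
Proof.
elim: s e => [|l s IH] e e0.
  by exists 0%N => A _ _; rewrite big1 ?ltW// => j _; rewrite /u big_nil.
have e20 : 0 < e / 2 by rewrite divr_gt0.
have [J1 sJ] := IH _ e20; have [J2 lJ] := coord_tail cS (x l) e20.
exists (maxn J1 J2) => A aA AJ.
rewrite /u; under eq_bigr do rewrite big_cons.
rewrite big_split/= [leRHS]splitr lerD//.
  by apply: lJ => // j /AJ; rewrite geq_max => /andP[].
by apply: sJ => // j /AJ; rewrite geq_max => /andP[].
Qed.

(** Phases turn the sum into the value of [psi] at a single vector [y]. The coordinates of [y] are
    bounded by [u s], and [coord_norming] transfers the bound to [|y|]. *)
Lemma functional_sum_le s (C : K) psi : dual_unit_ball psi ->
  (forall A, admissible A -> \sum_(j <- A) u s j <= C) ->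
  \sum_(l <- s) `|psi (x l)| <= C.
Proof.
move=> bpsi uC; apply/ler_addgt0Pr => e e0.
pose y := \sum_(l <- s) phase (psi (x l)) *: x l.
have -> : \sum_(l <- s) `|psi (x l)| = `|psi y|.
  rewrite linear_sum ger0_norm//.
    by apply: eq_bigr => l _; rewrite /= dualZ -phaseM.
  by apply: sumr_ge0 => l _; rewrite /= dualZ phaseM.
have [A aA yA] := coord_norming cS y e0.
apply: le_trans (bpsi y) (le_trans yA _); rewrite lerD2r (le_trans _ (uC _ aA))//.
apply: ler_sum => j _; rewrite linear_sum (le_trans (ler_norm_sum _ _ _))//.
apply: ler_sum => l _.
by rewrite /= dualZ normrM ler_piMl// norm_phase_le1.
Qed.

Variable phi : nat -> dual E.
Hypothesis phi0 : weakly_null_dual phi.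
Variable d : K.
Hypothesis d0 : 0 < d.
Hypothesis phid : forall N, exists2 n, (N <= n)%N & d <= `|phi n (x n)|.
Variable B : K.
Hypothesis xB : forall n, `|x n| <= B.

(** A geometric budget: it starts at [B], grows by [2^-1 ^+ k.+1] at step [k], and never exceeds
    [B + 1]. *)
Let C k := B + (1 - 2^-1 ^+ k).

(** [extends_past] and [extends_future] make the matrix [phi (m i) (x (m j))]
    diagonally dominant along the selected [m]; [extends_sum] is the [c_0]
    upper estimate on the partial sums of [x (m i)]. *)
Record extends (s : seq nat) (n : nat) : Prop := Extends {
  extends_gt : {in s, forall l, (l < n)%N};
  extends_diag : d <= `|phi n (x n)|;
  extends_past : \sum_(l <- s) `|phi n (x l)| <= d / 4;
  extends_future : {in s, forall l, `|phi l (x n)| <= d / 4 * 2^-1 ^+ (size s).+1};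
  extends_sum : (forall A, admissible A -> \sum_(j <- A) u s j <= C (size s)) ->
    forall A, admissible A -> \sum_(j <- A) u (n :: s) j <= C (size s).+1 }.

Lemma exists_extends s : exists n, extends s n.
Proof.
have d40 : 0 < d / 4 by rewrite divr_gt0.
have e0 k : 0 < 2^-1 ^+ k :> K by rewrite exprn_gt0// invr_gt0.
(* All requirements but [extends_diag] hold for every large [n]; [phid] then supplies a large [n]
   with the diagonal bound. *)
have [N _ sN] : \forall n \near \oo, [/\ {in s, forall l, (l < n)%N},
    \sum_(l <- s) `|phi n (x l)| <= d / 4,
    {in s, forall l, `|phi l (x n)| <= d / 4 * 2^-1 ^+ (size s).+1} &
    (forall A, admissible A -> \sum_(j <- A) u s j <= C (size s)) ->
    forall A, admissible A -> \sum_(j <- A) u (n :: s) j <= C (size s).+1].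
  have s1 : \forall n \near \oo, {in s, forall l, (l < n)%N}.
    by apply: near_all => l _; exact: nbhs_infty_gt.
  have s2 : \forall n \near \oo, \sum_(l <- s) `|phi n (x l)| <= d / 4.
    have e1 : 0 < d / 4 / (size s).+1%:R by rewrite divr_gt0.
    have : \forall n \near \oo,
        {in s, forall l, `|phi n (x l)| <= d / 4 / (size s).+1%:R}.
      apply: near_all => l _.
      by have /cvgr0Pnorm_le := weakly_null_dual_eval (x l) phi0; exact.
    apply: filterS => n ns; rewrite big_seq.
    apply: le_trans (ler_sum _ (fun l ls => ns l ls)) _; rewrite -big_seq.
    rewrite big_const_seq count_predT iter_addr_0 -[leLHS]mulr_natl mulrCA.
    by rewrite ler_piMr ?(ltW d40)// ler_pdivrMr// mul1r ler_nat.
  have s3 : \forall n \near \oo,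
      {in s, forall l, `|phi l (x n)| <= d / 4 * 2^-1 ^+ (size s).+1}.
    apply: near_all => l _.
    have /cvgr0Pnorm_le := uniformly_weakly_null_cvg (phi l) x0; apply.
    by rewrite mulr_gt0.
  have s4 : \forall n \near \oo,
      (forall A, admissible A -> \sum_(j <- A) u s j <= C (size s)) ->
      (* The bound is conditional on [s], so a list that violates it imposes nothing here; thus
         every list has an extension and [extension] is a total function. *)
      forall A, admissible A -> \sum_(j <- A) u (n :: s) j <= C (size s).+1.
    have [uC|nuC] := pselect (forall A, admissible A -> \sum_(j <- A) u s j <= C (size s));
      last by apply: nearW => n /nuC.
    have BC : B <= C (size s).
      by rewrite lerDl subr_ge0 exprn_ile1// invf_le1// ler1n.
    have := coord_sum_step cS x0 (coord_sum_tail s) xB BC uC (e0 (size s).+1).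
    apply: filterS => n nC _ A aA.
    have <- : C (size s) + 2^-1 ^+ (size s).+1 = C (size s).+1.
      by rewrite /C -addrA; congr (_ + _); rewrite exprS; field.
    have -> : \sum_(j <- A) u (n :: s) j = \sum_(j <- A) (u s j + `|c j (x n)|).
      by apply: eq_bigr => j _; rewrite /u big_cons addrC.
    exact: nC.
  by near=> n; split; near: n.
have [n Nn dn] := phid N; have [? ? ? ?] := sN n Nn; by exists n.
Unshelve. all: by end_near. Qed.

Definition extension s := sval (cid (exists_extends s)).

Lemma extensionP s : extends s (extension s).
Proof. exact: svalP (cid (exists_extends s)). Qed.

Fixpoint selected k : seq nat :=
  if k is k'.+1 then extension (selected k') :: selected k' else [::].

Definition selected_index k := extension (selected k).

Lemma size_selected k : size (selected k) = k.
Proof. by elim: k => //= k ->. Qed.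

Lemma big_selected (V : nmodType) (F : nat -> V) k :
  \sum_(l <- selected k) F l = \sum_(i < k) F (selected_index i).
Proof.
by elim: k => [|k IH]; rewrite ?big_nil ?big_ord0//= big_cons big_ord_recr/= IH addrC.
Qed.

Lemma mem_selected i k : (i < k)%N -> selected_index i \in selected k.
Proof.
elim: k => // k IH; rewrite ltnS leq_eqVlt in_cons => /orP[/eqP ->|/IH ->].
  by rewrite eqxx.
by rewrite orbT.
Qed.

Lemma selected_index_ge k : (k <= selected_index k)%N.
Proof.
elim: k => // k IH; apply: leq_ltn_trans IH _.
exact: (extends_gt (extensionP (selected k.+1))) (mem_selected (ltnSn k)).
Qed.

Lemma selected_sum_le k A : admissible A -> \sum_(j <- A) u (selected k) j <= C k.
Proof.
elim: k A => [|k IH] A aA.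
  rewrite /C expr0 subrr addr0 big1 ?(le_trans _ (xB 0))// => j _.
  by rewrite /u big_nil.
have := extends_sum (extensionP (selected k)); rewrite size_selected => /(_ IH).
exact.
Qed.

Lemma functional_selected_le psi : dual_unit_ball psi ->
  forall k, \sum_(i < k) `|psi (x (selected_index i))| <= B + 1.
Proof.
move=> bpsi k; rewrite -(big_selected (fun l => `|psi (x l)|)).
apply: functional_sum_le bpsi _ => A aA; apply: le_trans (selected_sum_le k aA) _.
by rewrite lerD2l gerBl exprn_ge0// invr_ge0.
Qed.

Lemma diagonal_sum_ge i k : (i < k)%N ->
  d / 2 <= `|\sum_(l < k) phi (selected_index i) (x (selected_index l))|.
Proof.
have d40 : 0 < d / 4 by rewrite divr_gt0.
(* The strengthened bound carries the induction: at [k = i.+1] the diagonal term minus the past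
   leaves [d - d / 4], and each later term costs at most the drop in [d / 4 * 2^-1 ^+ k]. *)
move=> ik; suff : d / 2 + d / 4 * 2^-1 ^+ k <=
    `|\sum_(l < k) phi (selected_index i) (x (selected_index l))|.
  by apply: le_trans; rewrite lerDl mulr_ge0 ?ltW// exprn_gt0// invr_gt0.
elim: k ik => // k IH; rewrite ltnS leq_eqVlt big_ord_recr/= => /orP[/eqP <-|ik].
  have eS := extensionP (selected i).
  apply: (@le_trans _ _ (d - d / 4)).
    rewrite [X in X - _](_ : d = d / 2 + d / 4 + d / 4); last by field.
    by rewrite addrK lerD2l ler_piMr ?(ltW d40)// exprn_ile1// invf_le1// ler1n.
  rewrite addrC; apply: le_trans (lerB_normD _ _).
  apply: lerB; first exact: extends_diag eS.
  apply: le_trans (ler_norm_sum _ _ _) _.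
  rewrite -(big_selected (fun l => `|phi (selected_index i) (x l)|)); exact: extends_past eS.
apply: le_trans (lerB_normD _ _).
have /(_ _ (mem_selected ik)) := extends_future (extensionP (selected k)).
rewrite size_selected => fk; apply: le_trans (lerB (IH ik) fk).
by rewrite le_eqVlt; apply/orP; left; apply/eqP; rewrite exprS; field.
Qed.

End Selection.

(** * Functionals on the dual given by series, and the weak Dunford-Pettis property *)

Definition summable_in (K : numFieldType) := forall (a : nat -> K^o) (C : K),
  (forall n, \sum_(i < n) `|a i| <= C) -> cvgn (fun n => \sum_(i < n) a i).

Section DunfordPettis.
Context {K : numFieldType} {E : completeNormedModType K}.
Hypothesis Ksum : summable_in K.

Section SumFunctional.
Variables (y : nat -> E) (C : K).
Hypothesis yC : forall psi : dual E, dual_unit_ball psi ->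
  forall k, \sum_(i < k) `|psi (y i)| <= C.

(** An element of the bidual: the series [\sum_i y i] need not converge in [E]. *)
Definition sum_functional (psi : dual E) : K^o :=
  lim ((\sum_(i < k) psi (y i)) @[k --> \oo] : set_system K^o).

Lemma sum_functional_cvg (psi : dual E) :
  (\sum_(i < k) psi (y i)) @[k --> \oo] --> sum_functional psi.
Proof.
have [M M0 bM] := dual_unit_ball_scale psi.
suff Ma : forall k, \sum_(i < k) `|psi (y i)| <= M * C.
  exact: (Ksum (a := fun i => psi (y i)) Ma).
move=> k; rewrite -ler_pdivrMl// mulr_sumr.
apply: le_trans (yC bM k); apply: ler_sum => i _.
by rewrite dualZE normrM normfV (gtr0_norm M0).
Qed.

Lemma sum_functional_linear : linear sum_functional.
Proof.
move=> a psi chi; apply: (@cvg_lim _ (@norm_hausdorff K K^o)).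
under eq_fun => k do (under eq_bigr => i _ do rewrite dualDE dualZE;
  rewrite big_split -mulr_sumr/=).
apply: (@cvgD K K^o); last exact: sum_functional_cvg.
apply: (@cvgZr K K^o); exact: sum_functional_cvg.
Qed.

Lemma sum_functional_le (psi : dual E) : dual_unit_ball psi -> `|sum_functional psi| <= C.
Proof.
move=> bpsi; apply/ler_addgt0Pr => e e0.
have /cvgrPdist_le/(_ _ e0)[k _ /(_ k (leqnn k)) Fk] := sum_functional_cvg (psi := psi).
rewrite -[sum_functional psi](subrK (\sum_(i < k) psi (y i))) addrC.
rewrite (le_trans (ler_normD _ _))// lerD//.
exact: le_trans (ler_norm_sum _ _ _) (yC bpsi k).
Qed.

End SumFunctional.

Lemma schreier_coordinates_weak_Dunford_Pettis (c : nat -> dual E) :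
  schreier_coordinates c -> weak_Dunford_Pettis E.
Proof.
move=> cS x phi x0 phi0; apply: contrapT => nphi.
have [d [d0 phid]] : exists d : K, 0 < d /\
    forall N, exists2 n, (N <= n)%N & d <= `|phi n (x n)|.
  apply: contrapT => nd; apply: nphi; apply/cvgr0Pnorm_lt => d d0.
  apply: contrapT => nN; apply: nd; exists d; split => // N.
  apply: contrapT => nn; apply: nN; exists N => // n /= Nn.
  rewrite (real_ltNge (normr_real _) (gtr0_real d0)); apply/negP => dn.
  by apply: nn; exists n.
have [B B0 xB] := uniformly_weakly_null_bounded cS x0.
pose m := selected_index cS x0 phi0 d0 phid xB.
have mC (psi : dual E) : dual_unit_ball psi ->
    forall k, \sum_(i < k) `|psi ((x \o m) i)| <= B + 1.
  exact: functional_selected_le.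
pose F : {linear dual E -> K^o} := HB.pack (sum_functional (x \o m))
  (GRing.isLinear.Build _ _ _ _ _ (sum_functional_linear mC)).
have bF : bounded_on_dual F.
  exists (B + 1); split => [|M BM psi bpsi].
    by rewrite ger0_real// addr_ge0.
  exact: le_trans (sum_functional_le mC bpsi) (ltW BM).
have d40 : 0 < d / 4 by rewrite divr_gt0.
have /cvgr0Pnorm_lt/(_ _ d40)[N _ NF] := phi0 F bF.
have := NF (m N) (selected_index_ge cS x0 phi0 d0 phid xB N).
have /cvgrPdist_lt/(_ _ d40)[k _ kF] := sum_functional_cvg mC (psi := phi (m N)).
(* The index is at least [k], so the partial sum is within [d / 4] of [F (phi (m N))], and beyond
   [N], so it contains the diagonal term and has modulus at least [d / 2]. But [F (phi (m N))] has
   modulus below [d / 4]. *)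
have := kF (maxn k N.+1) (leq_maxl _ _).
have := diagonal_sum_ge cS x0 phi0 d0 phid xB (leq_maxr k N.+1).
set S := \sum_(_ < _) _ => dS FS F4.
suff : d / 2 < d / 2 by rewrite ltxx.
apply: le_lt_trans dS _.
rewrite [ltRHS](_ : _ = d / 4 + d / 4); last by field.
apply: le_lt_trans (ltrD F4 FS).
rewrite -[X in `|X| <= _](subKr (F (phi (m N))) S).
exact: ler_normB.
Qed.

End DunfordPettis.

(** * Coordinates on the completion of c_00 *)

Definition complete_scalars (K : numFieldType) :=
  forall F : set_system K^o, ProperFilter F -> cauchy F -> cvg F.

Section CompletionCoordinates.
Context {K : numFieldType} {S : completeNormedModType K}.
Hypothesis Kc : complete_scalars K.
Variable i : {linear c00 K -> S}.
Hypothesis iS : is_completion i.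

Lemma completion_approx (y : S) (e : K) : 0 < e -> exists x, `|y - i x| < e.
Proof.
move=> e0; have [_ di] := iS.
have [|z [yz [x _ xz]]] := di (ball y e)^° _ (open_interior _).
  by exists y; apply: nbhsx_ballx.
by exists x; move: (interior_subset yz); rewrite -xz -ball_normE.
Qed.

Lemma c00_coord_le (x : c00 K) j : `|x j| <= `|i x|.
Proof.
have [-> _] := iS.
by have := schreier_norm_ge x (@admissible1 j); rewrite big_seq_fset1.
Qed.

(** The [j]-th coordinate of [y] is the limit of [x j] as [i x] tends to [y]; the
    inequality determines it and replaces the limit in what follows. *)
Lemma exists_coordinate j (y : S) :
  exists a : K, forall x : c00 K, `|a - x j| <= `|y - i x|.
Proof.
(* [F] is generated by the sets of [j]-th coordinates of finitely supported vectors close to [y]; it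
   is Cauchy by [c00_coord_le]. *)
pose F : set_system K^o := filter_from [set e : K | 0 < e]
  (fun e => [set (x : c00 K) j | x in [set x | `|y - i x| < e]]).
have FF : ProperFilter F.
  apply: filter_from_proper; last first.
    by move=> e /= e0; have [x xe] := completion_approx y e0; exists (x j), x.
  apply: filter_from_filter; first by exists 1 => /=.
  move=> e d /= e0 d0.
  have /orP[ed|de] := real_leVge (gtr0_real e0) (gtr0_real d0).
    exists e => // _ [x /= xe <-]; split; exists x => //=; exact: lt_le_trans xe _.
  exists d => // _ [x /= xd <-]; split; exists x => //=; exact: lt_le_trans xd _.
have cF : cauchy F.
  apply/cauchyP => e e0; have e20 : 0 < e / 2 by rewrite divr_gt0.
  have [x xe] := completion_approx y e20; exists (x j), (e / 2) => // _ [z ze <-].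
  rewrite -ball_normE /ball_/=.
  have -> : x j - z j = (x - z) j by [].
  rewrite (le_lt_trans (c00_coord_le _ _))// linearB.
  rewrite -(subrKA y) [ltRHS]splitr (le_lt_trans (ler_normD _ _))// ltrD//.
  by rewrite distrC.
have /cvg_ex[a Fa] := Kc FF cF; exists a => x; apply/ler_addgt0Pr => e e0.
have e20 : 0 < e / 2 by rewrite divr_gt0.
have [d /= d0 dF] : F [set b : K^o | `|a - b| < e / 2].
  by apply: Fa; apply/nbhs_ballP; exists (e / 2) => // b; rewrite -ball_normE.
have [m [m0 md me]] : exists m : K, [/\ 0 < m, m <= d & m <= e / 2].
  have /orP[?|?] := real_leVge (gtr0_real d0) (gtr0_real e20).
    by exists d.
  by exists (e / 2).
have [z zm] := completion_approx y m0.
have az : `|a - z j| < e / 2 by apply: dF; exists z => //=; exact: lt_le_trans md.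
rewrite -(subrKA (z j)) (le_trans (ler_normD _ _))//.
rewrite [e in leRHS]splitr addrCA lerD ?(ltW az)//.
have -> : z j - x j = (z - x) j by [].
rewrite (le_trans (c00_coord_le _ _))// linearB -(subrKA y).
rewrite (le_trans (ler_normD _ _))// addrC lerD//.
by rewrite distrC (le_trans (ltW zm)).
Qed.

Definition coordinate j (y : S) : K^o := sval (cid (exists_coordinate j y)).

Lemma coordinateP j y (x : c00 K) : `|coordinate j y - x j| <= `|y - i x|.
Proof. exact: (svalP (cid (exists_coordinate j y))). Qed.

Lemma coordinate_linear j : linear (coordinate j).
Proof.
move=> a y z; apply/subr0_eq/eqP; rewrite -normr_le0; apply/ler_addgt0Pr => e e0.
rewrite add0r.
have k0 : 0 < 2 * (`|a| + 1) by rewrite mulr_gt0// ltr_wpDl.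
(* The error [|a| * |y - i v| + |z - i w|] is counted twice, once for [a *: y + z] and once for [y]
   and [z] separately; this constant keeps the total within [e]. *)
have d0 : 0 < e / (2 * (`|a| + 1)) by rewrite divr_gt0.
have [v vy] := completion_approx y d0; have [w wz] := completion_approx z d0.
have cE : (a *: v + w) j = a * v j + w j by [].
rewrite -(subrKA (a * v j + w j)) -[X in `|_ + X|]opprB -cE.
rewrite (le_trans (ler_normB _ _))//.
apply: (@le_trans _ _ (`|a *: y + z - i (a *: v + w)| + (`|a| * `|y - i v| + `|z - i w|))).
  rewrite lerD ?coordinateP//.
  rewrite cE opprD addrACA -mulrBr (le_trans (ler_normD _ _))// normrM lerD//.
    by rewrite ler_wpM2l// coordinateP.
  exact: coordinateP.
rewrite linearP opprD addrACA -scalerBr.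
apply: (@le_trans _ _ ((`|a| * `|y - i v| + `|z - i w|) *+ 2)).
  by rewrite mulr2n lerD2r (le_trans (ler_normD _ _))// normrZ.
rewrite -mulr_natl -ler_pdivlMl//.
rewrite (_ : 2^-1 * e = `|a| * (e / (2 * (`|a| + 1))) + e / (2 * (`|a| + 1))).
  by rewrite lerD ?(ltW wz)// ler_wpM2l ?(ltW vy).
field.
by rewrite gt_eqF// ltr_wpDl.
Qed.

Lemma coordinate_completion j x : coordinate j (i x) = x j.
Proof.
apply/subr0_eq/eqP; rewrite -normr_le0 (le_trans (coordinateP _ _ x))//.
by rewrite subrr normr0.
Qed.

Lemma coordinate_sum_le A (y : S) :
  admissible A -> \sum_(j <- A) `|coordinate j y| <= `|y|.
Proof.
move=> aA; apply/ler_addgt0Pr => e e0; have [ii _] := iS.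
(* One error for each element of [A] and one for the norm must fit into [e]; the denominator exceeds
   their number by one. *)
have k0 : 0 < e / #|` A|.+2%:R by rewrite divr_gt0.
have [x yx] := completion_approx y k0.
apply: (@le_trans _ _ (\sum_(j <- A) (`|x j| + e / #|` A|.+2%:R))).
  apply: ler_sum => j _; rewrite -[coordinate j y](subrK (x j)) addrC.
  rewrite (le_trans (ler_normD _ _))// lerD2l.
  by rewrite (le_trans (coordinateP _ _ _))// ltW.
rewrite big_split/= big_const_seq count_predT iter_addr_0.
apply: (@le_trans _ _ (`|i x| + e / #|` A|.+2%:R *+ #|` A|)).
  by rewrite lerD2r ii schreier_norm_ge.
apply: (@le_trans _ _ (`|y| + e / #|` A|.+2%:R + e / #|` A|.+2%:R *+ #|` A|)).
  rewrite lerD2r -[i x](subrK y) addrC (le_trans (ler_normD _ _))// lerD2l.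
  by rewrite distrC ltW.
rewrite -addrA lerD2l -mulrS -[leLHS]mulr_natl mulrCA ler_piMr ?(ltW e0)//.
by rewrite ler_pdivrMr// mul1r ler_nat.
Qed.

Lemma coordinate_le j (y : S) : `|coordinate j y| <= 1 * `|y|.
Proof.
rewrite mul1r; have := coordinate_sum_le y (@admissible1 j).
by rewrite big_seq_fset1.
Qed.

Definition coordinate_dual j : dual S :=
  Dual (is_dual_bounded (coordinate_linear j) (coordinate_le j)).

Lemma schreier_coordinates_completion : schreier_coordinates coordinate_dual.
Proof.
have [ii _] := iS; split=> [A y|y e e0|y e e0].
- exact: coordinate_sum_le.
- have e20 : 0 < e / 2 by rewrite divr_gt0.
  have [x yx] := completion_approx y e20.
  (* The set that norms the approximant nearly norms [y]: passing from [y] to [i x] and back costs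
     [e / 2] each way. *)
  have [A aA Amax] := schreier_norm_attained x; exists A => //.
  apply: (@le_trans _ _ (`|i x| + e / 2)).
    by rewrite -[y in leLHS](subrK (i x)) addrC (le_trans (ler_normD _ _))// lerD2l ltW.
  rewrite [X in _ <= _ + X]splitr addrA lerD2r ii.
  apply: le_trans (schreier_norm_le Amax) _.
  apply: (@le_trans _ _ (\sum_(j <- A) (`|coordinate j y| + `|coordinate j (i x - y)|))).
    apply: ler_sum => j _; rewrite -(coordinate_completion j x).
    rewrite -[in leLHS](subrK y (i x)) [i x - y + y]addrC.
    rewrite (_ : coordinate j _ = coordinate_dual j (y + (i x - y)))// linearD.
    exact: ler_normD.
  rewrite big_split lerD2l (le_trans (coordinate_sum_le _ aA))//.
  by rewrite distrC ltW.
have [x yx] := completion_approx y e0.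
have /asboolP/finite_fsetP[D xD] := c00_funP x.
(* Beyond the support of [x], [y] and [y - i x] have the same coordinates, so the sum is at most
   [|y - i x| < e]. *)
exists (\max_(j <- D) j).+1 => A aA AJ.
apply: le_trans (ltW yx); apply: le_trans (coordinate_sum_le _ aA).
rewrite big_seq [leRHS]big_seq; apply: ler_sum => j jA.
rewrite [in leRHS](_ : coordinate j _ = coordinate_dual j (y - i x))// linearB/=.
rewrite coordinate_completion (_ : x j = 0) ?subr0//.
apply: contrapT => /eqP xj; have jD : j \in D.
  by have : [set j | x j != 0] j by []; rewrite xD.
have := @leq_bigmax_seq _ (enum_fset D) xpredT id j jD isT.
by rewrite leqNgt (AJ _ jA).
Qed.
End CompletionCoordinates.

(** * Subspaces and scalar fields *)

Section Restriction.
Context {K : numFieldType} {E : normedModType K} (Y : closed_subspace E).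

Lemma restriction_linear (phi : dual E) :
  linear (fun y : subspace_type Y => phi (\val y)).
Proof. by move=> a y z; exact: (dual_linear phi a (\val y) (\val z)). Qed.

Lemma restriction_bounded (phi : dual E) : exists M : K,
  forall y : subspace_type Y, `|phi (\val y)| <= M * `|y|.
Proof. by have [M _ bM] := dual_bounded phi; exists M => y; exact: bM. Qed.

Definition restriction (phi : dual E) : dual (subspace_type Y) :=
  Dual (is_dual_bounded (restriction_linear phi)
    (svalP (cid (restriction_bounded phi)))).

Lemma schreier_coordinates_restriction (c : nat -> dual E) :
  schreier_coordinates c -> schreier_coordinates (restriction \o c).
Proof.
move=> [c1 c2 c3]; split=> [A y|y e e0|y e e0].
- exact: c1.
- exact: c2.
- exact: c3.
Qed.

End Restriction.

Lemma schreier_hereditary_weak_Dunford_Pettis (K : numFieldType)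
    (S : completeNormedModType K) : complete_scalars K -> summable_in K ->
  is_schreier_space S -> hereditary_weak_Dunford_Pettis S.
Proof.
move=> Kc Ks [i iS] Y.
apply: (schreier_coordinates_weak_Dunford_Pettis Ks).
exact: schreier_coordinates_restriction (schreier_coordinates_completion Kc iS).
Qed.

(** * Completeness and absolute summability for real and complex scalars *)

Section Scalars.
Variable R : realType.

Lemma complete_real : complete_scalars R.
Proof. by move=> F FF; exact: cauchy_cvg. Qed.

Lemma summable_real : summable_in R.
Proof.
move=> a C aC; have : cvgn (series (a : R ^nat)); last by rewrite seriesEord.
apply: normed_cvg; apply: nondecreasing_is_cvgn.
  by apply: nondecreasing_series => n _ _; exact: normr_ge0.
by exists C => _ [n _ <-]; rewrite /normed_series_of/= /series/= big_mkord.
Qed.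

Implicit Types z : R[i].

Lemma norm_real_complex (r : R) : `|r%:C%C| = `|r|%:C%C :> R[i].
Proof. by rewrite normc_def /= expr0n addr0 sqrtr_sqr. Qed.

Lemma normc_ge_Im z : `|complex.Im z|%:C%C <= `|z|.
Proof. by rewrite normc_def lecR -sqrtr_sqr ler_wsqrtr// lerDr sqr_ge0. Qed.

Lemma normc_le_ReIm z : `|z| <= (`|complex.Re z| + `|complex.Im z|)%:C%C.
Proof.
rewrite {1}[z]complexE rmorphD (le_trans (ler_normD _ _))// normrM.
by rewrite !norm_real_complex normc_def /= expr0n add0r expr1n sqrtr1 mul1r.
Qed.

Lemma gt0_complexE z : 0 < z -> exists2 r : R, 0 < r & z = r%:C%C.
Proof.
move=> z0; have zE := RRe_real (gtr0_real z0).
by exists (complex.Re z) => //; move: z0; rewrite -zE ltcR.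
Qed.

Lemma cvg_complex (T : Type) (F : set_system T) (f : T -> R[i]^o) (a b : R) :
  Filter F -> complex.Re (f t) @[t --> F] --> a ->
  complex.Im (f t) @[t --> F] --> b -> f t @[t --> F] --> ((a +i* b)%C : R[i]^o).
Proof.
move=> FF fa fb; apply/cvgrPdist_lt => _ /gt0_complexE[r r0 ->].
have r20 : 0 < r / 2 by rewrite divr_gt0.
move/cvgrPdist_lt : fa => /(_ _ r20) fa; move/cvgrPdist_lt : fb => /(_ _ r20) fb.
near=> t; apply: le_lt_trans (normc_le_ReIm _) _.
rewrite ltcR [ltRHS]splitr ltrD//.
  have : `|a - complex.Re (f t)| < r / 2 by near: t.
  by case: (f t).
have : `|b - complex.Im (f t)| < r / 2 by near: t.
by case: (f t).
Unshelve. all: by end_near. Qed.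

Lemma complete_complex : complete_scalars R[i].
Proof.
move=> F FF /cauchyP cF.
have cRe : cvg (complex.Re (z : R[i]) @[z --> F]).
  apply: cauchy_cvg; apply/cauchyP => e e0.
  have [|z Fz] := cF e%:C%C; first by rewrite ltcR.
  exists (complex.Re z); apply: (@filterS _ F _ (ball z e%:C%C)) Fz => w.
  rewrite /= -!ball_normE => zw.
  rewrite /ball_/= -ltcR; apply: le_lt_trans (zw : `|z - w| < _).
  by have := normc_ge_Re (z - w); case: z {zw} => ? ?; case: w.
have cIm : cvg (complex.Im (z : R[i]) @[z --> F]).
  apply: cauchy_cvg; apply/cauchyP => e e0.
  have [|z Fz] := cF e%:C%C; first by rewrite ltcR.
  exists (complex.Im z); apply: (@filterS _ F _ (ball z e%:C%C)) Fz => w.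
  rewrite /= -!ball_normE => zw.
  rewrite /ball_/= -ltcR; apply: le_lt_trans (zw : `|z - w| < _).
  by have := normc_ge_Im (z - w); case: z {zw} => ? ?; case: w.
move/cvg_ex : cRe => [a Fa]; move/cvg_ex : cIm => [b Fb].
by apply/cvg_ex; exists (a +i* b)%C; exact: (@cvg_complex _ F id).
Qed.

Lemma summable_complex : summable_in R[i].
Proof.
move=> a C aC.
(* [C] bounds an empty sum, so it is nonnegative and hence real; its real part then bounds the sums
   of the real and of the imaginary parts. *)
have C0 : 0 <= C by have := aC 0%N; rewrite big_ord0.
have CE := RRe_real (ger0_real C0).
have partE (g : R[i] -> R) : (forall z, `|g z|%:C%C <= `|z|) ->
    cvgn (fun n => \sum_(i < n) g (a i)).
  move=> gle; apply: (@summable_real (g \o a) (complex.Re C)) => n.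
  rewrite -lecR CE rmorph_sum (le_trans _ (aC n))//.
  by apply: ler_sum => j _; exact: gle.
have /cvg_ex[r cr] := partE _ (@normc_ge_Re R).
have /cvg_ex[s cs] := partE _ normc_ge_Im.
apply/cvg_ex; exists (r +i* s)%C; apply: cvg_complex.
  rewrite [X in X @ _](_ : _ = fun n => \sum_(i < n) complex.Re (a i))//.
  by apply/funext => n; elim/big_rec2: _ => // k ? [? ?] _ <-; case: (a k).
rewrite [X in X @ _](_ : _ = fun n => \sum_(i < n) complex.Im (a i))//.
by apply/funext => n; elim/big_rec2: _ => // k ? [? ?] _ <-; case: (a k).
Qed.

End Scalars.

Theorem theorem10 (R : realType) :
  (forall S : completeNormedModType R,
     is_schreier_space S -> hereditary_weak_Dunford_Pettis S) /\
  (forall S : completeNormedModType R[i],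
     is_schreier_space S -> hereditary_weak_Dunford_Pettis S).
Proof.
split=> S; apply: schreier_hereditary_weak_Dunford_Pettis.
- exact: complete_real.
- exact: summable_real.
- exact: complete_complex.
- exact: summable_complex.
Qed.
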